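(* Let $H$ be a real Hilbert space, let $K\subset H$ be a nonempty closed convex set, and let $A:H\to H$ be a single-valued monotone mapping satisfying: (a) $A$ is $\theta$-Lipschitz continuous for some $\theta>0$, i.e. $\|Ax-Ay\|\le\theta\|x-y\|$ for all $x,y\in H$; (b) $A$ is $\mu$-inverse strongly monotone for some $\mu>0$, i.e. $\langle Ax-Ay,x-y\rangle\ge\mu\|Ax-Ay\|^2$ for all $x,y\in H$. Let $0<\lambda<2\mu$, and assume that the variational inequality problem $$\text{find }x^*\in K\text{ such that }\langle Ax^*,x-x^*\rangle\ge 0\quad\text{for all }x\in K \qquad(\mathrm{VIP})$$ has a solution. Let $B:H\to H$ be a strongly positive bounded linear operator with constant $\bar\gamma>0$, let $Q:H\to H$ be a contraction mapping with constant $\alpha\in(0,1)$, and let $\gamma$ be a real number such that $0<\gamma<\frac{\bar\gamma}{\alpha}<\gamma+\frac1\alpha$. Let $\{x_n\}_{n\ge0}$ be a sequence in $H$ generated by the implicit scheme $$x_{n+1}=\alpha_n\gamma Q(x_n)+(I-\alpha_nB)\,P_K(I-\lambda A)\!\left(\frac{x_n+x_{n+1}}{2}\right),\qquad n\ge 0,$$ where $\{\alpha_n\}$ is a sequence in $(0,1)$ satisfying: (i) $\lim_{n\to\infty}\alpha_n=0$; (ii) $\sum_{n=0}^{\infty}\alpha_n=\infty$; (iii) $\sum_{n=1}^{\infty}|\alpha_n-\alpha_{n-1}|<\infty$ or $\lim_{n\to\infty}\frac{\alpha_{n+1}}{\alpha_n}=1$. Then $\{x_n\}$ converges strongly to a solution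 $z$ of (VIP), and, writing $S:=P_K(I-\lambda A)$, $z$ is also the unique solution in $\mathrm{Fix}(S)$ of the variational inequality $$\langle (B-\gamma Q)z,\,x-z\rangle\ge 0\qquad\text{for all }x\in\mathrm{Fix}(S).$$
   Context: $\langle\cdot,\cdot\rangle$ and $\|\cdot\|$ denote the inner product and norm of $H$, and $I$ is the identity operator on $H$. $P_K$ denotes the metric (nearest point) projection of $H$ onto $K$. $\mathrm{Fix}(S)$ is the set of fixed points of $S$. A mapping $Q:H\to H$ is a contraction mapping with constant $\alpha\in(0,1)$ if $\|Qx-Qy\|\le\alpha\|x-y\|$ for all $x,y\in H$. A bounded linear operator $B:H\to H$ is strongly positive with constant $\bar\gamma>0$ if $\langle Bx,x\rangle\ge\bar\gamma\|x\|^2$ for all $x\in H$. *)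

(* Defs.v *)
(* Real Hilbert spaces are rendered as a complete normed module H over a
   realType R together with an inner product ip : {dot H for idfun}
   (symmetric, bilinear, positive definite) that induces the norm of H. *)
From HB Require Import structures.
From mathcomp Require Import all_boot all_order all_algebra.
From mathcomp Require Import all_classical all_reals all_analysis.

Set Implicit Arguments.
Unset Strict Implicit.
Unset Printing Implicit Defensive.

Import Order.TTheory GRing.Theory Num.Theory.
Import numFieldNormedType.Exports.

Local Open Scope classical_set_scope.
Local Open Scope ring_scope.

Section HilbertOperators.
Context {R : realType} {H : completeNormedModType R}.
Implicit Types (ip : {dot H for idfun}) (A B F : H -> H) (K C : set H).

Definition induces_norm ip := forall u : H, ip u u = `|u| ^+ 2.

Definition monotone_map ip A :=
  forall u v : H, 0 <= ip (A u - A v) (u - v).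

Definition inverse_strongly_monotone ip (mu : R) A :=
  forall u v : H, mu * `|A u - A v| ^+ 2 <= ip (A u - A v) (u - v).

Definition strongly_positive ip (gbar : R) B :=
  forall u : H, gbar * `|u| ^+ 2 <= ip (B u) u.

Definition bounded_operator B :=
  exists M : R, forall u : H, `|B u| <= M * `|u|.

Definition nearest_point K (u p : H) :=
  K p /\ forall v : H, K v -> `|u - p| <= `|u - v|.

(* The default value 0 is only reached when u has no nearest point in K, which
   does not happen for K nonempty, closed and convex in a Hilbert space. *)
Definition metric_proj K (u : H) : H := xget 0 [set p | nearest_point K u p].

Definition Fix (S : H -> H) : set H := [set u | S u = u].

Definition solves_VI ip F C (z : H) :=
  C z /\ forall u : H, C u -> 0 <= ip (F z) (u - z).

Definition proj_step K A (lambda : R) (u : H) : H :=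
  metric_proj K (u - lambda *: A u).

End HilbertOperators.

(* Main.v *)
(* The map S = P_K (I - lambda A) is nonexpansive and Fix S is the solution set
   of (VIP), so it suffices to treat the scheme for a nonexpansive S. The
   resolvents z_c of S, given by z_c - S z_c = c (u - z_c), converge strongly
   to the projection z of u on Fix S as c tends to 0 (Halpern): monotonicity of
   I - S makes |u - z_c| monotone in c and bounds |z_c - z_c'|^2 by the
   variation of |u - z_c|^2. The same monotonicity bounds <u - z, x - z>
   whenever x is nearly fixed by S, which avoids weak compactness. The operator
   B - gamma Q is strongly monotone and Lipschitz, so the variational
   inequality on Fix S is solved by the fixed point z of a projected gradient
   step. The iterates are bounded, and a recursive inequality s' <= (1 - b) s +
   b d + e with divergent sum of b gives successively x_(n+1) - x_n -> 0, hence
   x_n - S x_n -> 0, and |x_n - z|^2 -> 0. B is not assumed self-adjoint, so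
   the usual bound |I - s B| <= 1 - s gbar is replaced by |(I - s B) u|^2 <= (1
   - 2 s g) |u|^2 for any fixed g below the strong positivity constant and all
   small s. *)
Require Import Defs.
From HB Require Import structures.
From mathcomp Require Import all_boot all_order all_algebra.
From mathcomp Require Import all_classical all_reals all_analysis.
From mathcomp Require Import ring lra.

Set Implicit Arguments.
Unset Strict Implicit.
Unset Printing Implicit Defensive.

Import Order.TTheory GRing.Theory Num.Theory.
Import numFieldNormedType.Exports.

Local Open Scope classical_set_scope.
Local Open Scope ring_scope.

(** * Inner product calculus and the Cauchy-Schwarz inequality *)

Section InnerProduct.
Context {R : realType} {H : completeNormedModType R} (ip : {dot H for idfun})
  (ip_norm : induces_norm ip).
Implicit Types (u v w : H) (s : R).

Lemma ip_sym u v : ip u v = ip v u.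
Proof. by rewrite hermC expr0 mul1r. Qed.

Lemma ipDl u v w : ip (u + v) w = ip u w + ip v w.
Proof. exact: linearDl. Qed.

Lemma ipDr u v w : ip w (u + v) = ip w u + ip w v.
Proof. exact: linearDr. Qed.

Lemma ipNl u w : ip (- u) w = - ip u w.
Proof. exact: linearNl. Qed.

Lemma ipNr u w : ip w (- u) = - ip w u.
Proof. exact: linearNr. Qed.

Lemma ipZl s u w : ip (s *: u) w = s * ip u w.
Proof. exact: linearZl_LR. Qed.

Lemma ipZr s u w : ip w (s *: u) = s * ip w u.
Proof. exact: linearZr_LR. Qed.

Definition ipE := (ipDl, ipDr, ipNl, ipNr, ipZl, ipZr).

Lemma sqr_normD u v : `|u + v| ^+ 2 = `|u| ^+ 2 + 2 * ip u v + `|v| ^+ 2.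
Proof. by rewrite -!ip_norm !ipE (ip_sym v u); ring. Qed.

Lemma sqr_normB u v : `|u - v| ^+ 2 = `|u| ^+ 2 - 2 * ip u v + `|v| ^+ 2.
Proof. by rewrite -!ip_norm !ipE (ip_sym v u); ring. Qed.

(** Squaring the triangle inequality of the given norm yields Cauchy-Schwarz directly. *)
Lemma ip_le_norm u v : ip u v <= `|u| * `|v|.
Proof.
have : `|u + v| ^+ 2 <= (`|u| + `|v|) ^+ 2.
  by rewrite lerXn2r ?nnegrE ?addr_ge0 ?ler_normD.
by rewrite sqr_normD sqrrD; lra.
Qed.

(** The two sides differ by [|v| ^+ 2]. Pairing the perturbation [v] with the full sum suits an
    implicit step, where [u + v] is the new error. *)
Lemma sqr_normD_le u v : `|u + v| ^+ 2 <= `|u| ^+ 2 + 2 * ip v (u + v).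
Proof.
rewrite sqr_normD ipDr ip_norm (ip_sym v u).
have := sqr_ge0 `|v|; lra.
Qed.

End InnerProduct.

(** * Contractions and Cauchy sequences *)

Section Completeness.
Context {R : realType} {H : completeNormedModType R}.

Lemma lipschitzP (k : R) (f : H -> H) :
  k.-lipschitz f <-> forall u v, `|f u - f v| <= k * `|u - v|.
Proof.
by split=> [Lf u v|Lf [u v] _]; [exact: (Lf (u, v))|exact: Lf].
Qed.

Lemma contraction_fixpoint (k : R) (f : H -> H) :
  0 <= k -> k < 1 -> k.-lipschitz f -> exists p, f p = p.
Proof.
move=> k0 k1 Lf.
have mapf : set_fun setT setT f by [].
pose fm := HB.pack_for {fun [set: H] >-> [set: H]} f
  (isFun.Build _ _ setT setT f mapf).
have ctr : is_contraction fm by exists (NngNum k0).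
have [|p _ pE] := banach_fixed_point ctr closedT; first by exists 0.
by exists p; rewrite [in RHS]pE.
Qed.

Lemma cvgn_sqr_cauchy (w : nat -> H) :
  (forall e : R, 0 < e -> exists N, forall m n,
     (N <= m)%N -> (m <= n)%N -> `|w m - w n| ^+ 2 <= e) ->
  cvgn w.
Proof.
move=> Cw; apply/cauchy_cvgP/cauchy_exP => e e0.
have [|N wN] := Cw ((e / 2) ^+ 2); first by rewrite exprn_gt0// divr_gt0.
exists (w N); exists N => // n /= Nn; rewrite -ball_normE /=.
rewrite (@le_lt_trans _ _ (e / 2))//; last lra.
by have := wN N n (leqnn N) Nn; rewrite ler_sqr ?nnegrE// divr_ge0// ltW.
Qed.

End Completeness.

(** * Metric projection on a closed convex set *)

Section Projection.
Context {R : realType} {H : completeNormedModType R} (ip : {dot H for idfun})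
  (ip_norm : induces_norm ip).
Implicit Types (C : set H) (u v p q : H).

Lemma convex_set_line C (C_convex : convex_set (C : set (convex_lmodType H)))
    u v (t : R) :
  0 <= t -> t <= 1 -> C u -> C v -> C (u + t *: (v - u)).
Proof.
move=> t0 t1 Cu Cv.
have := C_convex v u (Itv01 t0 t1) (mem_set Cv) (mem_set Cu).
rewrite inE; congr (C _).
by rewrite /conv/= -[unstable.onem t]/(1 - t) scalerBl scale1r scalerBr addrCA.
Qed.

Lemma small_multiple_le0 (x M : R) :
  (forall t, 0 < t -> t <= 1 -> x <= t * M) -> x <= 0.
Proof.
move=> xM; rewrite leNgt; apply/negP => x0.
have M0 : 0 < M by have := xM 1 ltr01 (lexx _); lra.
have x1 := xM _ ltr01 (lexx _).
(* The case t = 1 gives x <= M, so t = x / (2 M) is admissible, and it yields x <= x / 2. *)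
have := xM (x / (2 * M)); rewrite divr_gt0 ?mulr_gt0// => /(_ isT).
have -> : x / (2 * M) * M = x / 2 by field; rewrite gt_eqF.
rewrite ler_pdivrMr ?mulr_gt0//; lra.
Qed.

(** A minimizing sequence for the squared distance is Cauchy by the parallelogram law. Its limit
    satisfies the first-order condition, found by moving from [p] towards [v]. *)
Lemma exists_projection C u : C !=set0 -> closed C ->
    convex_set (C : set (convex_lmodType H)) ->
  exists2 p, C p & forall v, C v -> ip (u - p) (v - p) <= 0.
Proof.
move=> [c0 Cc0] C_closed C_convex.
pose E : set R := [set `|u - v| ^+ 2 | v in C].
have E_lb : lbound E 0 by move=> _ [v _ <-]; exact: sqr_ge0.
have E_inf : has_inf E by split; [exists (`|u - c0| ^+ 2), c0|exists 0].
have /choice[w wP] : forall n, exists v,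
    C v /\ `|u - v| ^+ 2 < inf E + n.+1%:R^-1.
  move=> n.
  have [|_ [v Cv <-] v_lt] := @inf_adherent _ E n.+1%:R^-1 _ E_inf.
    by rewrite invr_gt0.
  by exists v.
have infE v : C v -> inf E <= `|u - v| ^+ 2.
  by move=> Cv; apply: ge_inf; [exists 0|exists v].
have w_dist m n : `|w m - w n| ^+ 2 <= 2 * (m.+1%:R^-1 + n.+1%:R^-1).
  have [[Cm wm] [Cn wn]] := (wP m, wP n).
  have half01 : 0 <= 2^-1 :> R by [].
  have half1 : 2^-1 <= 1 :> R by lra.
  (* The midpoint of [w m] and [w n] lies in [C], so its squared distance to [u] is at least
     [inf E]; the parallelogram law turns this into the bound. *)
  have := infE _ (convex_set_line C_convex half01 half1 Cm Cn).
  have -> : u - (w m + 2^-1 *: (w n - w m)) = 2^-1 *: ((u - w m) + (u - w n)).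
    have -> : w n - w m = (u - w m) - (u - w n)
      by rewrite opprB [RHS]addrC addrA subrK.
    rewrite opprD addrA; move: (u - w m) (u - w n) => y z.
    rewrite scalerBr scalerDr opprB addrCA [LHS]addrC; congr (_ + _).
    by rewrite -[X in X - _]scale1r -scalerBl; congr (_ *: _); lra.
  have -> : w m - w n = (u - w n) - (u - w m)
    by rewrite opprB [RHS]addrC addrA subrK.
  move: wm wn;
    rewrite normrZ exprMn (sqr_normB ip_norm (u - w n)) (sqr_normD ip_norm (u
      - w m)).
  rewrite (ip_sym ip (u - w n)) ger0_norm// (_ : 2^-1 ^+ 2 = 4^-1);
    last by field.
  move: (inf E) m.+1%:R^-1 n.+1%:R^-1 => d s t wm wn mid; lra.
have w_cvg : cvgn w.
  apply: cvgn_sqr_cauchy => e e0.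
  have [N _ NP] := near_infty_natSinv_lt (PosNum (divr_gt0 e0 (ltr0n _ 4))).
  exists N => m n Nm mn; apply: le_trans (w_dist m n) _.
  have := NP m Nm; have := NP n (leq_trans Nm mn) => /=.
  by move: m.+1%:R^-1 n.+1%:R^-1 => s t; lra.
set p := limn w.
have Cp : C p.
  by apply: closed_cvg w_cvg => //; apply: nearW => n; have [] := wP n.
exists p => // v Cv.
have p_min : `|u - p| ^+ 2 <= inf E.
  have up : `|u - w n| * `|u - w n| @[n --> \oo] --> `|u - p| * `|u - p|.
    by apply: cvgM; apply: cvg_norm; apply: cvgB => //; exact: cvg_cst.
  have inf_cvg : inf E + n.+1%:R^-1 @[n --> \oo] --> inf E + 0.
    by apply: cvgD; [exact: cvg_cst|exact: cvg_harmonic].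
  rewrite expr2 -[leRHS]addr0; apply: ler_cvg_to up inf_cvg _.
  by apply: nearW => n; rewrite -expr2; have [_ /ltW] := wP n.
apply: (@small_multiple_le0 _ (`|v - p| ^+ 2)) => t t0 t1.
have := le_trans p_min (infE _ (convex_set_line C_convex (ltW t0) t1 Cp Cv)).
rewrite opprD addrA (sqr_normB ip_norm _ (t *: _)) ipZr normrZ exprMn
  (gtr0_norm t0).
have := sqr_ge0 `|v - p| => v0 h.
have : t * (2 * ip (u - p) (v - p)) <= t * (t * `|v - p| ^+ 2) by lra.
rewrite ler_pM2l// => h2.
have : 0 <= t * `|v - p| ^+ 2 by rewrite mulr_ge0// ltW.
lra.
Qed.

(** The obtuse angle at [p] gives |u - p|^2 + |v - p|^2 <= |u - v|^2, so [p] is the only nearest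
    point and the choice made by [xget] must return it. *)
Lemma metric_proj_eq C u p :
  C p -> (forall v, C v -> ip (u - p) (v - p) <= 0) -> metric_proj C u = p.
Proof.
move=> Cp pP.
have dist v : C v -> `|u - p| ^+ 2 + `|v - p| ^+ 2 <= `|u - v| ^+ 2.
  move=> /pP ip_le0; have -> : u - v = (u - p) - (v - p).
    by rewrite opprB addrA subrK.
  by rewrite (sqr_normB ip_norm (u - p)); lra.
rewrite /metric_proj; case: xgetP => [q _ [Cq q_min]|/(_ p)[]].
  apply/eqP; rewrite -subr_eq0 -normr_eq0 -sqrf_eq0 eq_le sqr_ge0 andbT.
  have := dist q Cq; have : `|u - q| ^+ 2 <= `|u - p| ^+ 2.
    by rewrite lerXn2r ?nnegrE// q_min.
  by lra.
split=> // v Cv; rewrite -ler_sqr ?nnegrE//; apply: le_trans (dist v Cv).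
by rewrite lerDl sqr_ge0.
Qed.

Lemma metric_projP C u : C !=set0 -> closed C ->
    convex_set (C : set (convex_lmodType H)) ->
  C (metric_proj C u) /\
  forall v, C v -> ip (u - metric_proj C u) (v - metric_proj C u) <= 0.
Proof.
move=> C0 C_closed C_convex.
by have [p Cp pP] := exists_projection u C0 C_closed C_convex;
  rewrite (metric_proj_eq Cp pP).
Qed.

(** Adding the hypotheses gives |p - q|^2 <= <u - v, p - q>. Only the angle conditions enter, so
    this serves projections on [K] and on [Fix S] alike. *)
Lemma projection_nonexpansive u v p q :
  ip (u - p) (q - p) <= 0 -> ip (v - q) (p - q) <= 0 -> `|p - q| <= `|u - v|.
Proof.
move=> up vq.
have : `|p - q| ^+ 2 <= ip (u - v) (p - q).
  rewrite -ip_norm; move: up vq.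
  rewrite !ipE (ip_sym ip q p); lra.
move=> /le_trans/(_ (ip_le_norm ip_norm _ _)).
have [->|pq0] := eqVneq `|p - q| 0; first by rewrite normr_ge0.
by rewrite expr2 ler_pM2r // lt_neqAle eq_sym pq0 normr_ge0.
Qed.

End Projection.

(** * Resolvents of a nonexpansive map and projection on its fixed points *)

Section FixedPointProjection.
Context {R : realType} {H : completeNormedModType R} (ip : {dot H for idfun})
  (ip_norm : induces_norm ip).
Context (S : H -> H) (S_nonexp : forall u v, `|S u - S v| <= `|u - v|).
Implicit Types (u v p x z : H) (c : R).

Lemma displacement_monotone u v : 0 <= ip ((u - S u) - (v - S v)) (u - v).
Proof.
have : ip (S u - S v) (u - v) <= ip (u - v) (u - v).
  rewrite ip_norm; apply: le_trans (ip_le_norm ip_norm _ _) _.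
  by rewrite expr2 ler_wpM2r.
by rewrite !ipE; lra.
Qed.

(** The equation reads z = (c u + S z) / (1 + c), a fixed point problem for a contraction of
    constant 1 / (1 + c). *)
Lemma exists_resolvent u c : 0 < c -> exists z, z - S z = c *: (u - z).
Proof.
move=> c0; pose k := (1 + c)^-1.
have c1 : 1 + c != 0 by rewrite gt_eqF// addr_gt0.
have k0 : 0 < k by rewrite invr_gt0 addr_gt0.
have k1 : k < 1 by rewrite invf_lt1 ?ltrDl// addr_gt0.
have [|z zE] := @contraction_fixpoint R H k
  (fun y => k *: (c *: u + S y)) (ltW k0) k1.
  apply/lipschitzP => x y; rewrite /= -scalerBr normrZ gtr0_norm// ler_pM2l//.
  by rewrite opprD addrACA subrr add0r.
exists z; have : (1 + c) *: z = c *: u + S z.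
  by rewrite -[in LHS]zE scalerA divff// scale1r.
rewrite scalerDl scale1r scalerBr => zE'.
by apply/eqP; rewrite subr_eq addrAC eq_sym subr_eq zE'.
Qed.

(** Since c (u - z) = z - S z, monotonicity of I - S replaces this displacement by that of [x]. *)
Lemma resolvent_ip_le u c z x : 0 < c -> z - S z = c *: (u - z) ->
  ip (u - z) (x - z) <= c^-1 * (`|x - S x| * `|x - z|).
Proof.
move=> c0 zE; rewrite ler_pdivlMl//.
have := ip_le_norm ip_norm (x - S x) (x - z).
have := displacement_monotone z x; rewrite zE.
by rewrite !ipE; lra.
Qed.

Lemma resolvent_dist_fixed u c z p : 0 < c -> z - S z = c *: (u - z) ->
  Fix S p -> `|u - z| <= `|u - p|.
Proof.
move=> c0 zE Sp; rewrite -ler_sqr ?nnegrE//.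
have -> : u - p = (u - z) - (p - z) by rewrite opprB addrA subrK.
rewrite (sqr_normB ip_norm (u - z)).
have := resolvent_ip_le p c0 zE; rewrite Sp subrr normr0 mul0r mulr0.
have := sqr_ge0 `|p - z|; lra.
Qed.

(** With a = u - z and b = u - z', monotonicity gives (c - c') <a, b - a> >= c' |b - a|^2 >= 0,
    hence <a, b> >= |a|^2; expanding |b - a|^2 concludes. *)
Lemma resolvent_sqr_dist u c c' z z' : 0 < c' -> c' < c ->
    z - S z = c *: (u - z) -> z' - S z' = c' *: (u - z') ->
  `|z - z'| ^+ 2 <= `|u - z'| ^+ 2 - `|u - z| ^+ 2.
Proof.
move=> c'0 c'c zE z'E.
have := displacement_monotone z z'; rewrite zE z'E.
have -> : z - z' = (u - z') - (u - z) by rewrite opprB [RHS]addrC addrA subrK.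
have := sqr_ge0 `|(u - z') - (u - z)|; rewrite (sqr_normB ip_norm (u - z')).
move: (u - z') (u - z) => b a ab0.
rewrite !ipE !ip_norm (ip_sym ip b a) => mono.
suff : (c - c') * (`|a| ^+ 2 - ip a b) <= 0
  by rewrite pmulr_rle0 ?subr_gt0//; lra.
have : 0 <= c' * (`|b| ^+ 2 - 2 * ip a b + `|a| ^+ 2).
  by rewrite mulr_ge0 ?(ltW c'0)// -(ip_sym ip b a).
lra.
Qed.

Lemma resolvents_cvg u p (z : nat -> H) : Fix S p ->
    (forall k, z k - S (z k) = k.+1%:R^-1 *: (u - z k)) ->
  cvgn z.
Proof.
move=> Sp zE; pose g k := `|u - z k| ^+ 2.
have inv_gt0 k : 0 < k.+1%:R^-1 :> R by rewrite invr_gt0.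
have z_dist m n : (m <= n)%N -> `|z m - z n| ^+ 2 <= g n - g m.
  rewrite leq_eqVlt => /predU1P[->|mn]; first by rewrite !subrr normr0 expr0n.
  apply: (@resolvent_sqr_dist u _ _ _ _ (inv_gt0 n) _ (zE m) (zE n)).
  by rewrite ltf_pV2 ?posrE// ltr_nat.
have g_cvg : cvgn g.
  apply: nondecreasing_is_cvgn.
    by move=> m n mn; rewrite -subr_ge0; apply: le_trans (z_dist m n mn);
      exact: sqr_ge0.
  exists (`|u - p| ^+ 2) => _ [k _ <-]; rewrite ler_sqr ?nnegrE//.
  exact: resolvent_dist_fixed (inv_gt0 k) (zE k) Sp.
apply: cvgn_sqr_cauchy => e e0.
have /cvgrPdist_le/(_ (e / 2)) := g_cvg.
rewrite divr_gt0// => /(_ isT)[N _ gN].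
exists N => m n Nm mn; apply: le_trans (z_dist m n mn) _.
have := gN m Nm; have := gN n (leq_trans Nm mn) => /=.
by rewrite !ler_norml => /andP[? ?] /andP[? ?]; lra.
Qed.

(* The estimate replaces demiclosedness and weak compactness: for x in Fix S it
   says that z is the projection of u on Fix S. *)
Lemma exists_fix_projection u : Fix S !=set0 -> exists2 z, Fix S z &
  forall D e : R, 0 < e -> exists2 d : R, 0 < d &
    forall x, `|x - z| <= D -> `|x - S x| <= d -> ip (u - z) (x - z) <= e.
Proof.
move=> [p Sp].
have inv_gt0 k : 0 < k.+1%:R^-1 :> R by rewrite invr_gt0.
have /choice[w wE] : forall k, exists z, z - S z = k.+1%:R^-1 *: (u - z).
  by move=> k; exact: exists_resolvent.
have w_cvg := resolvents_cvg Sp wE; set z := limn w in w_cvg.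
have w_bound k : `|u - w k| <= `|u - p|.
  exact: resolvent_dist_fixed (inv_gt0 k) (wE k) Sp.
have w_near (e : R) : 0 < e -> \forall k \near \oo, `|w k - z| <= e.
  move=> e0; have /cvgrPdist_le/(_ e e0) := w_cvg.
  by apply: filterS => k; rewrite distrC.
exists z.
  have Sz_cvg : S (w k) @[k --> \oo] --> S z.
    apply/cvgrPdist_le => e e0; near=> k.
    rewrite distrC; apply: le_trans (S_nonexp _ _) _.
    by near: k; exact: w_near.
  have disp_cvg : w k - S (w k) @[k --> \oo] --> z - S z by exact: cvgB.
  have disp_cvg0 : w k - S (w k) @[k --> \oo] --> (0 : R) *: (u - z).
    under eq_fun do rewrite wE.
    by apply: cvgZ; [exact: cvg_harmonic|apply: cvgB => //; exact: cvg_cst].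
  (* The displacements of [w k] tend both to z - S z and to 0. *)
  apply/esym/eqP; rewrite -subr_eq0; apply/eqP.
  by rewrite -(scale0r (u - z)); exact: (cvg_unique _ disp_cvg disp_cvg0).
move=> D e e0.
(* [D1] bounds |x - w k| once |w k - z| <= 1, and |w k - z| E bounds the error of replacing [z] by
   [w k]. The index [k] is fixed before [d], which absorbs the factor k + 1 from the resolvent
   estimate. *)
pose D1 := `|D| + 1; pose E := D1 + `|u - p|.
have D1_gt0 : 0 < D1 by rewrite ltr_wpDl.
have E_gt0 : 0 < E by rewrite ltr_pwDl.
near \oo => k.
have wk1 : `|w k - z| <= 1 by near: k; exact: w_near.
have wkE : `|w k - z| <= e / 2 / E by near: k; apply: w_near; rewrite !divr_gt0.
exists (k.+1%:R^-1 * (e / 2 / D1)); first by rewrite !mulr_gt0// invr_gt0.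
move=> x xD xS.
have xwD : `|x - w k| <= D1.
  apply: le_trans (ler_distD z _ _) _; rewrite lerD// ?(distrC z)//.
  exact: le_trans (ler_norm _).
have -> : ip (u - z) (x - z) =
    ip (u - w k) (x - w k) + (ip (w k - z) (x - z) + ip (u - w k) (w k - z)).
  by rewrite !ipE; ring.
have h1 : ip (u - w k) (x - w k) <= e / 2.
  apply: le_trans (resolvent_ip_le x (inv_gt0 k) (wE k)) _.
  rewrite ler_pdivrMl//;
    apply: (@le_trans _ _ (k.+1%:R^-1 * (e / 2 / D1) * D1)).
    by rewrite ler_pM.
  by rewrite -mulrA divfK ?gt_eqF.
have h2 : ip (w k - z) (x - z) + ip (u - w k) (w k - z) <= `|w k - z| * E.
  rewrite mulrDr; apply: lerD; apply: le_trans (ip_le_norm ip_norm _ _) _.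
    rewrite ler_wpM2l//; apply: le_trans xD _; apply: le_trans (ler_norm _) _.
    by rewrite lerDl.
  by rewrite mulrC ler_wpM2l.
have h3 : `|w k - z| * E <= e / 2 by rewrite -ler_pdivlMr.
lra.
Unshelve. all: by end_near.
Qed.

End FixedPointProjection.

(** * Variational inequalities for strongly monotone Lipschitz maps *)

Section StronglyMonotoneVI.
Context {R : realType} {H : completeNormedModType R} (ip : {dot H for idfun})
  (ip_norm : induces_norm ip).
Context (F : H -> H) (eta : R) (eta_gt0 : 0 < eta)
  (F_strong : forall u v, eta * `|u - v| ^+ 2 <= ip (F u - F v) (u - v)).

Lemma strongly_monotone_VI_unique (C : set H) z w :
  solves_VI ip F C z -> solves_VI ip F C w -> w = z.
Proof.
move=> [Cz zP] [Cw wP].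
have := F_strong w z; have := zP w Cw; have := wP z Cz.
have -> : ip (F w - F z) (w - z) = - ip (F w) (z - w) - ip (F z) (w - z).
  by rewrite !ipE; ring.
move=> hw hz h; apply/eqP; rewrite -subr_eq0 -normr_eq0 -sqrf_eq0 eq_le sqr_ge0.
by rewrite andbT -(pmulr_rle0 _ eta_gt0); lra.
Qed.

Lemma gradient_step_contraction L : (forall u v, `|F u - F v| <=
  L * `|u - v|) ->
  exists2 s : R, 0 < s & exists k : R, [/\ 0 <= k, k < 1 &
    forall u v, `|(u - s *: F u) - (v - s *: F v)| <= k * `|u - v|].
Proof.
(* The squared factor is at most 1 - 2 s eta + s^2 L^2. This [s] gives s^2 L^2 <= s eta, leaving 1 -
   s eta <= (1 - s eta / 2)^2; the term eta^2 keeps [m] positive and s eta <= 1. *)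
move=> F_lip; pose m := L ^+ 2 + eta ^+ 2; pose s := eta / m.
have m_gt0 : 0 < m by rewrite ltr_wpDl ?sqr_ge0// exprn_gt0.
have s_gt0 : 0 < s by rewrite divr_gt0.
have sm : s * m = eta by rewrite divfK ?gt_eqF.
have seta : s * eta <= 1.
  by rewrite mulrAC ler_pdivrMr// mul1r -expr2 lerDr sqr_ge0.
clearbody s; have se_gt0 : 0 < s * eta by rewrite mulr_gt0.
exists s => //; exists (1 - s * eta / 2); split; [lra|lra|] => u v.
have k0 : 0 <= 1 - s * eta / 2 by lra.
rewrite -ler_sqr ?nnegrE// ?mulr_ge0//.
have -> : u - s *: F u - (v - s *: F v) = (u - v) - s *: (F u - F v).
  by rewrite scalerBr [in RHS]opprB opprD opprK addrACA; congr (_ + _);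
    exact: addrC.
rewrite (sqr_normB ip_norm (u - v)) ipZr normrZ exprMn (gtr0_norm s_gt0) exprMn.
have Fuv : `|F u - F v| ^+ 2 <= L ^+ 2 * `|u - v| ^+ 2.
  rewrite -exprMn lerXn2r ?nnegrE// (le_trans (normr_ge0 (F u - F v)))//.
have := F_strong u v; rewrite (ip_sym ip (u - v)).
move: Fuv (sqr_ge0 `|u - v|).
move: (`|u - v| ^+ 2) (`|F u - F v| ^+ 2) (ip _ _) => d f g fd d0 dg.
have h1 : s ^+ 2 * f <= s ^+ 2 * (L ^+ 2 * d) by rewrite ler_wpM2l ?sqr_ge0.
have h2 : 2 * s * (eta * d) <= 2 * s * g by rewrite ler_wpM2l// mulr_ge0// ltW.
have h3 : s ^+ 2 * L ^+ 2 <= s * eta.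
  by rewrite -[in leRHS]sm /m; have := sqr_ge0 (s * eta); lra.
have h4 : s ^+ 2 * L ^+ 2 * d <= s * eta * d by rewrite ler_wpM2r.
have h5 : 0 <= (s * eta) ^+ 2 * d by rewrite mulr_ge0 ?sqr_ge0.
lra.
Qed.

Lemma exists_fix_VI (S : H -> H) L :
    (forall u v, `|S u - S v| <= `|u - v|) -> Fix S !=set0 ->
    (forall u v, `|F u - F v| <= L * `|u - v|) ->
  exists2 z, solves_VI ip F (Fix S) z &
    forall D e : R, 0 < e -> exists2 d : R, 0 < d &
      forall x, `|x - z| <= D -> `|x - S x| <= d -> - ip (F z) (x - z) <= e.
Proof.
move=> S_nonexp S_fix F_lip.
have /choice[P PP] : forall u, exists z, Fix S z /\ forall D e : R, 0 < e ->
    exists2 d : R, 0 < d & forall x, `|x - z| <= D -> `|x - S x| <= d ->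
      ip (u - z) (x - z) <= e.
  move=> u; have [z Sz zP] := exists_fix_projection ip_norm S_nonexp u S_fix.
  by exists z.
(* A fixed point has zero displacement, so the estimate holds for every e > 0. *)
have P_fix u p : Fix S p -> ip (u - P u) (p - P u) <= 0.
  move=> Sp; apply/ler_addgt0Pl => e e0; rewrite addr0.
  have [_ /(_ `|p - P u| e e0)[d d0 dP]] := PP u; apply: dP => //.
  by rewrite Sp subrr normr0 ltW.
have [s s0 [k [k0 k1 step]]] := gradient_step_contraction F_lip.
have [|z zE] := @contraction_fixpoint R H k (fun u => P (u - s *: F u)) k0 k1.
  apply/lipschitzP => u v /=; apply: le_trans _ (step u v).
  by apply: (projection_nonexpansive ip_norm); apply: P_fix; exact: (PP _).1.
(* As [z] is the projection of z - s F z, the projection estimate becomes the one for -F z, scaled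
   by [s]. *)
have uzE x : ip (z - s *: F z - z) (x - z) = s * - ip (F z) (x - z).
  by rewrite addrAC subrr add0r ipNl ipZl mulrN.
have [Sz zP] := PP (z - s *: F z); rewrite zE in Sz zP.
exists z.
  split=> // p /(P_fix (z - s *: F z)); rewrite zE uzE pmulr_rle0//; lra.
move=> D e e0; have [|d d0 dP] := zP D (s * e); first by rewrite mulr_gt0.
by exists d => // x xD xS; have := dP x xD xS; rewrite uzE ler_pM2l.
Qed.

End StronglyMonotoneVI.

(** * A recursive inequality forcing convergence to zero *)

Section Recursion.
Context {R : realType}.

Lemma recursive_cvg0 (s b d e : nat -> R) :
    (forall n, 0 <= s n) -> (forall n, 0 <= e n) ->
    (\forall n \near \oo, 0 <= b n <= 1) ->
    (\forall n \near \oo, s n.+1 <= (1 - b n) * s n + b n * d n + e n) ->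
    series b n @[n --> \oo] --> +oo ->
    (forall eps, 0 < eps -> \forall n \near \oo, d n <= eps) ->
    cvgn (series e) ->
  s n @[n --> \oo] --> 0.
Proof.
move=> s0 e0 b01 rec b_sum d_le e_cvg.
apply/cvgr0Pnorm_le => eps eps0.
(* One third each covers [d], the tail sums of [e], and the remainder [t]. *)
pose del := eps / 3; have del0 : 0 < del by rewrite divr_gt0.
have /cvgrPdist_le/(_ (del / 2)) := e_cvg.
rewrite divr_gt0// => /(_ isT) e_near.
have [N _ NP] : \forall n \near \oo, [/\ 0 <= b n <= 1,
    s n.+1 <= (1 - b n) * s n + b n * d n + e n, d n <= del &
    `|limn (series e) - series e n| <= del / 2].
  by near=> n; split; near: n => //; exact: d_le.
pose E n := series e n - series e N; pose B n := series b n - series b N.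
have E_le n : (N <= n)%N -> E n <= del.
  move=> Nn; have [_ _ _ ] := NP n Nn; have [_ _ _ ] := NP N (leqnn N).
  by rewrite /E !ler_norml => /andP[? ?] /andP[? ?]; lra.
have seriesS (f : nat -> R) n : series f n.+1 = series f n + f n.
  by rewrite /series /= big_nat_recr.
have EB0 k : 0 <= E (N + k)%N /\ 0 <= B (N + k)%N.
  elim: k => [|k [E0 B0]]; first by rewrite addn0 /E /B !subrr.
  have [/andP[b0 _] _ _ _] := NP (N + k)%N (leq_addr _ _).
  rewrite addnS /E /B !seriesS; move: E0 B0 (e0 (N + k)%N); rewrite /E /B;
    split; lra.
(* Subtracting [del] and the accumulated errors leaves t(n+1) <= (1 - b) t(n). As (1 - b)(1 + B + b)
   <= 1 + B, a positive [t] keeps t (1 + B) <= C, which avoids infinite products. *)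
pose t n := s n - del - E n; pose C := `|t N|.
have t_le k : t (N + k)%N <= 0 \/ t (N + k)%N * (1 + B (N + k)%N) <= C.
  elim: k => [|k IH].
    by right; rewrite addn0 /B subrr addr0 mulr1 ler_norm.
  have [/andP[b0 b1] recn dn _] := NP (N + k)%N (leq_addr _ _).
  have [E0 B0] := EB0 k.
  have tS : t (N + k.+1)%N <= (1 - b (N + k)%N) * t (N + k)%N.
    have bd : b (N + k)%N * d (N + k)%N <= b (N + k)%N * del
      by rewrite ler_wpM2l.
    have bE : 0 <= b (N + k)%N * E (N + k)%N by rewrite mulr_ge0.
    rewrite addnS /t {1}/E seriesS; move: bE; rewrite /E; lra.
  have BS : B (N + k.+1)%N = B (N + k)%N + b (N + k)%N.
    by rewrite addnS /B seriesS; lra.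
  have c0 : 0 <= 1 - b (N + k)%N by lra.
  have [t0|t0] := lerP (t (N + k)%N) 0.
    by left; apply: le_trans tS _; rewrite mulr_ge0_le0.
  right; case: IH => [|IH]; first by rewrite leNgt t0.
  rewrite BS; apply: le_trans IH.
  have BS0 : 0 <= 1 + (B (N + k)%N + b (N + k)%N) by lra.
  apply: le_trans (ler_wpM2r BS0 tS) _.
  rewrite [_ * t _]mulrC -mulrA ler_pM2l//.
  have : 0 <= b (N + k)%N * (B (N + k)%N + b (N + k)%N)
    by rewrite mulr_ge0// addr_ge0.
  lra.
(* Beyond [M] one has B n >= C / del, which excludes t n > del. *)
have /cvgryPge/(_ (C / del + series b N)) [M _ MP] := b_sum.
exists (maxn M N) => // n /=; rewrite geq_max => /andP[Mn Nn].
have := MP n Mn; rewrite /= -lerBrDr ler_pdivrMr// -/(B n) => CB.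
rewrite ger0_norm//; have := E_le n Nn.
suff : t n <= del by rewrite /t /del; lra.
have := t_le (n - N)%N; have := EB0 (n - N)%N; rewrite subnKC// => -[_ B0].
case=> [tn0|tn]; first exact: le_trans (ltW del0).
rewrite leNgt; apply/negP => dt.
have : del * (1 + B n) < t n * (1 + B n) by rewrite ltr_pM2r//; lra.
lra.
Unshelve. all: by end_near. Qed.

End Recursion.

(** * Midpoints, index shifts and divergent series *)

Lemma half_double (R : realType) (V : lmodType R) (u : V) :
  (2^-1 : R) *: (u + u) = u.
Proof.
rewrite scalerDr -scalerDl (_ : 2^-1 + 2^-1 = 1) ?scale1r//; lra.
Qed.

Lemma near_succ (P : nat -> Prop) :
  (\forall n \near \oo, P n) -> \forall n \near \oo, P n.+1.
Proof. by case=> N _ NP; exists N => // n /= Nn; apply: NP; exact: leqW. Qed.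

Section Divergence.
Context {R : realType}.

Lemma series_scale_shift_pinfty (a : nat -> R) (c : R) : 0 < c ->
  series a n @[n --> \oo] --> +oo ->
  series (fun n => c * a n.+1) n @[n --> \oo] --> +oo.
Proof.
move=> c0 /cvgryPge a_sum; apply/cvgryPge => A.
have [N _ NP] := a_sum (A / c + a 0%N).
exists N => // n /= Nn; have := NP n.+1 (leqW Nn).
rewrite /= /series /= big_nat_recl// -mulr_sumr [A / c + _]addrC lerD2l.
by rewrite ler_pdivrMr// mulrC.
Qed.

Lemma series_scale_pinfty (a : nat -> R) (c : R) : 0 < c ->
  series a n @[n --> \oo] --> +oo ->
  series (fun n => c * a n) n @[n --> \oo] --> +oo.
Proof.
move=> c0 /cvgryPge a_sum; apply/cvgryPge => A.
have [N _ NP] := a_sum (A / c).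
exists N => // n /NP /=; rewrite /series /= -mulr_sumr.
by rewrite ler_pdivrMr// mulrC.
Qed.

End Divergence.

(** * The implicit midpoint scheme for a nonexpansive map *)

Section ImplicitMidpoint.
Context {R : realType} {H : completeNormedModType R} (ip : {dot H for idfun})
  (ip_norm : induces_norm ip).
Context (S : H -> H) (S_nonexp : forall u v, `|S u - S v| <= `|u - v|)
  (S_fix : Fix S !=set0).
(* In the application f = gamma Q, kappa = gamma alpha and kappa + 2 tau = gbar;
   kappa + tau is the damping rate of I - s B for small s. *)
Context (kappa tau : R) (kappa_ge0 : 0 <= kappa) (tau_gt0 : 0 < tau).
Context (B : {linear H -> H}) (M : R) (B_bound : forall u, `|B u| <= M * `|u|)
  (B_strong : strongly_positive ip (kappa + 2 * tau) B).
Context (f : H -> H) (f_lip : forall u v, `|f u - f v| <= kappa * `|u - v|).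
Context (a : nat -> R) (a_gt0 : forall n, 0 < a n)
  (a_cvg0 : a n @[n --> \oo] --> (0 : R))
  (a_sum : series a n @[n --> \oo] --> +oo)
  (a_var : cvgn (series (fun n => `|a n.+1 - a n|)) \/
           a n.+1 / a n @[n --> \oo] --> (1 : R)).
Context (x : nat -> H).
Let y n := S (2^-1 *: (x n + x n.+1)).
Context (x_scheme : forall n, x n.+1 = y n + a n *: (f (x n) - B (y n))).

(** The first bound lets half of the surplus in strong positivity absorb s^2 |B u|^2; the second
    keeps 1 - 2 s (kappa + tau) nonnegative. *)
Let small (s : R) := s * M ^+ 2 <= 2 * tau /\ s * (2 * (kappa + tau)) <= 1.

Lemma damping_sqr s u : 0 <= s -> small s ->
  `|u - s *: B u| ^+ 2 <= (1 - 2 * s * (kappa + tau)) * `|u| ^+ 2.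
Proof.
move=> s0 [sM _]; rewrite (sqr_normB ip_norm) ipZr normrZ exprMn ger0_norm//.
have Bu : `|B u| ^+ 2 <= M ^+ 2 * `|u| ^+ 2.
  by rewrite -exprMn lerXn2r ?nnegrE// (le_trans (normr_ge0 (B u))).
have := B_strong u; rewrite (ip_sym ip u); move: Bu (sqr_ge0 `|u|).
move: (`|B u| ^+ 2) (`|u| ^+ 2) (ip _ _) => b d g bd d0 dg.
have h1 : s ^+ 2 * b <= s ^+ 2 * (M ^+ 2 * d) by rewrite ler_wpM2l ?sqr_ge0.
have h2 : s * ((kappa + 2 * tau) * d) <= s * g by rewrite ler_wpM2l.
have h3 : (s * d) * (s * M ^+ 2) <= (s * d) * (2 * tau).
  by rewrite ler_wpM2l// mulr_ge0.
lra.
Qed.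

Lemma damping s u : 0 <= s -> small s ->
  `|u - s *: B u| <= (1 - s * (kappa + tau)) * `|u|.
Proof.
move=> s0 ss; have c0 : 0 <= 1 - s * (kappa + tau).
  have : 0 <= s * (kappa + tau) by rewrite mulr_ge0// addr_ge0// ltW.
  by case: ss => _; lra.
rewrite -ler_sqr ?nnegrE ?mulr_ge0//; apply: le_trans (damping_sqr u s0 ss) _.
rewrite exprMn ler_wpM2r ?sqr_ge0//.
have := sqr_ge0 (s * (kappa + tau)); lra.
Qed.

Lemma stepB s u u' v v' :
  (v + s *: (f u - B v)) - (v' + s *: (f u' - B v')) =
  ((v - v') - s *: B (v - v')) + s *: (f u - f u').
Proof.
rewrite [B (v - v')]linearB; move: (B v) (B v') (f u) (f u') => b b' g g'.
rewrite opprD addrACA -scalerBr -[RHS]addrA -scalerN -scalerDr.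
congr (_ + _ *: _); rewrite !opprB [RHS]addrC.
by rewrite [LHS]addrACA [RHS]addrACA [- b + _]addrC.
Qed.

(** This compares an iterate with a fixed point (u' = v' = p) and also two consecutive iterates. *)
Lemma step_dist s u u' v v' : 0 <= s -> small s ->
  `|(v + s *: (f u - B v)) - (v' + s *: (f u' - B v'))| <=
  (1 - s * (kappa + tau)) * `|v - v'| + s * kappa * `|u - u'|.
Proof.
move=> s0 ss; rewrite stepB; apply: le_trans (ler_normD _ _) _.
rewrite lerD ?damping// normrZ ger0_norm// -mulrA ler_wpM2l//.
Qed.

Lemma near_small : \forall n \near \oo, small (a n).
Proof.
have near_le (m c : R) : 0 <= m -> 0 < c -> \forall n \near \oo, a n * m <= c.
  move=> m0 c0; have m1 : 0 < m + 1 by rewrite ltr_wpDl.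
  have /cvgr0Pnorm_le/(_ (c / (m + 1))) := a_cvg0.
  rewrite divr_gt0// => /(_ isT); apply: filterS => n.
  rewrite ger0_norm ?(ltW (a_gt0 n))// ler_pdivlMr//.
  have := a_gt0 n; lra.
near=> n; split; near: n; apply: near_le => //.
- exact: sqr_ge0.
- by rewrite mulr_gt0.
- by rewrite mulr_ge0// addr_ge0// ltW.
Unshelve. all: by end_near. Qed.

Lemma midpoint_dist n p : Fix S p ->
  `|y n - p| <= (`|x n - p| + `|x n.+1 - p|) / 2.
Proof.
move=> Sp; rewrite -{1}Sp; apply: le_trans (S_nonexp _ _) _.
have -> : 2^-1 *: (x n + x n.+1) - p = 2^-1 *: ((x n - p) + (x n.+1 - p)).
  by rewrite -[in LHS](half_double p) -scalerBr opprD addrACA.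
by rewrite normrZ ger0_norm// mulrC ler_wpM2r// ler_normD.
Qed.

Lemma iterates_bounded p : Fix S p ->
  exists2 D, 0 <= D & \forall n \near \oo, `|x n - p| <= D.
Proof.
move=> Sp; have [N _ NP] := near_small.
pose C := `|f p - B p|; have C0 : 0 <= C by exact: normr_ge0.
(* The term C / tau makes C <= tau D, so the margin [tau] compensates the drift of the step at
   [p]. *)
exists (`|x N - p| + C / tau).
  by rewrite addr_ge0// divr_ge0// ltW.
exists N => // n /= /subnKC <-; elim: (n - N)%N => [|k].
  by rewrite addn0 lerDl divr_ge0// ltW.
rewrite addnS; set m := (N + k)%N.
have ss : small (a m) by apply: NP; rewrite /= leq_addr.
have CD : C <= tau * (`|x N - p| + C / tau).
  by rewrite mulrDr [_ * (C / _)]mulrC divfK ?gt_eqF// lerDr mulr_ge0// ltW.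
move: (`|x N - p| + C / tau) CD => D CD rD.
have am := a_gt0 m.
have : `|x m.+1 - p| <= (1 - a m * (kappa + tau)) * `|y m - p| +
    a m * kappa * `|x m - p| + a m * C.
  have -> : x m.+1 - p = (y m + a m *: (f (x m) - B (y m))) -
      (p + a m *: (f p - B p)) + a m *: (f p - B p).
    by rewrite x_scheme opprD addrA subrK.
  apply: le_trans (ler_normD _ _) _; rewrite normrZ (gtr0_norm am) lerD2r.
  by apply: step_dist => //; exact: ltW.
move: ss => [_ ss]; have := midpoint_dist m Sp.
move: (`|x m.+1 - p|) (`|x m - p|) (`|y m - p|) rD => r' r w rD wr r'le.
have sk0 : 0 <= a m * (kappa + tau) by rewrite mulr_ge0 ?addr_ge0// ltW.
have c0 : 0 <= 1 - a m * (kappa + tau) by lra.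
have h1 := ler_wpM2l c0 wr.
have h2 : (1 - a m * (kappa + tau) + 2 * (a m * kappa)) * r <=
    (1 - a m * (kappa + tau) + 2 * (a m * kappa)) * D.
  by rewrite ler_wpM2l// addr_ge0// mulr_ge0// mulr_ge0// ltW.
have h3 : a m * C <= a m * (tau * D) by rewrite ler_wpM2l// ltW.
(* The midpoint puts half of the new error on the right; moving it left and doubling produces this
   factor. *)
have h4 : 0 < 1 + a m * (kappa + tau).
  by rewrite ltr_pwDl.
rewrite -(ler_pM2l h4); lra.
Qed.

Lemma forcing_bounded :
  exists2 L, 0 <= L & \forall n \near \oo, `|f (x n) - B (y n)| <= L.
Proof.
have [p Sp] := S_fix; have [D D0 near_D] := iterates_bounded Sp.
have M0 : 0 <= `|M| by [].
exists (kappa * D + `|f p - B p| + `|M| * D) => [|].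
  by rewrite !addr_ge0// mulr_ge0.
near=> n.
have xD : `|x n - p| <= D by near: n.
have x'D : `|x n.+1 - p| <= D by near: n; exact: (near_succ near_D).
have yD : `|y n - p| <= D by apply: le_trans (midpoint_dist n Sp) _; lra.
have -> : f (x n) - B (y n) = (f (x n) - f p) + (f p - B p) - B (y n - p).
  by rewrite [B (y n - p)]linearB subrKA opprB subrKA.
apply: le_trans (ler_normB _ _) _; apply: lerD.
  apply: le_trans (ler_normD _ _) _; rewrite lerD2r.
  by apply: le_trans (f_lip _ _) _; rewrite ler_wpM2l.
apply: le_trans (B_bound _) _; apply: (@le_trans _ _ (`|M| * `|y n - p|)).
  by rewrite ler_wpM2r// ler_norm.
by rewrite ler_wpM2l.
Unshelve. all: by end_near. Qed.

Lemma increment_rec n L : small (a n.+1) -> 0 <= L ->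
  `|f (x n) - B (y n)| <= L ->
  `|x n.+2 - x n.+1| <= (1 - tau * a n.+1) * `|x n.+1 - x n| +
                        2 * L * `|a n.+1 - a n|.
Proof.
move=> ss L0 vL; have a0 := a_gt0 n.+1.
have : `|x n.+2 - x n.+1| <= (1 - a n.+1 * (kappa + tau)) * `|y n.+1 - y n| +
    a n.+1 * kappa * `|x n.+1 - x n| + L * `|a n.+1 - a n|.
  (* The step from [x n] is redone with parameter [a n.+1], so that both steps share it; the
     correction carries a(n+1) - a(n). *)
  have -> : x n.+2 - x n.+1 = (y n.+1 + a n.+1 *: (f (x n.+1) - B (y n.+1))) -
      (y n + a n.+1 *: (f (x n) - B (y n))) +
      (a n.+1 - a n) *: (f (x n) - B (y n)).
    rewrite [in LHS]x_scheme [x n.+1 as Y in _ - Y]x_scheme scalerBl.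
    by rewrite !opprD -[RHS]addrA; congr (_ + _); rewrite subrKA.
  apply: le_trans (ler_normD _ _) _; apply: lerD.
    by apply: step_dist => //; exact: ltW.
  by rewrite normrZ mulrC ler_wpM2r.
have : `|y n.+1 - y n| <= (`|x n.+2 - x n.+1| + `|x n.+1 - x n|) / 2.
  apply: le_trans (S_nonexp _ _) _.
  rewrite -scalerBr normrZ ger0_norm// mulrC ler_wpM2r//.
  have -> : x n.+1 + x n.+2 - (x n + x n.+1) =
      (x n.+2 - x n.+1) + (x n.+1 - x n).
    by rewrite [x n + _]addrC opprD addrACA subrr add0r subrKA.
  exact: ler_normD.
move: (`|x n.+2 - x n.+1|) (`|x n.+1 - x n|) (normr_ge0 (x n.+1 - x n)).
move: (`|y n.+1 - y n|) (`|a n.+1 - a n|) (normr_ge0 (a n.+1 - a n)).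
move=> w e e0 d' d d0 wd d'le; case: ss => _ ss.
move: (a n.+1) a0 ss d'le => s s0 ss d'le.
have sk0 : 0 <= s * (kappa + tau) by rewrite mulr_ge0 ?addr_ge0// ltW.
have c0 : 0 <= 1 - s * (kappa + tau) by lra.
have h1 := ler_wpM2l c0 wd.
have h2 : 0 <= (tau * s) * (1 - s * (kappa + tau)) * d.
  by rewrite !mulr_ge0// ltW.
have h3 : 0 <= s * (kappa + tau) * (L * e).
  by rewrite mulr_ge0// mulr_ge0.
have h4 : 0 < 1 + s * (kappa + tau) by rewrite ltr_pwDl.
rewrite -(ler_pM2l h4); lra.
Qed.

Lemma increments_cvg0 : `|x n.+1 - x n| @[n --> \oo] --> (0 : R).
Proof.
have [L L0 near_L] := forcing_bounded.
have near_small' := near_succ near_small.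
have near_rec : \forall n \near \oo,
    `|x n.+2 - x n.+1| <= (1 - tau * a n.+1) * `|x n.+1 - x n| +
                          2 * L * `|a n.+1 - a n|.
  by near=> n; apply: increment_rec => //; near: n.
have b01 : \forall n \near \oo, 0 <= tau * a n.+1 <= 1.
  near=> n; have a0 := a_gt0 n.+1; rewrite mulr_ge0 ?ltW//=.
  have [_] : small (a n.+1) by near: n.
  have : 0 <= a n.+1 * kappa by rewrite mulr_ge0// ltW.
  have : 0 < tau * a n.+1 by rewrite mulr_gt0.
  lra.
have b_sum := series_scale_shift_pinfty tau_gt0 a_sum.
(* Summable variation enters the recursion as [e]; in the ratio case the same term factors as
   [b n * d n] with [d] tending to 0. *)
case: a_var => [var_cvg|ratio_cvg].
  apply: (recursive_cvg0 (b := fun n => tau * a n.+1) (d := fun=> 0)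
    (e := fun n => 2 * L * `|a n.+1 - a n|)) => //.
  - by move=> n; rewrite !mulr_ge0.
  - by apply: filterS near_rec => n; rewrite mulr0 addr0.
  - by move=> eps eps0; apply: nearW => n; exact: ltW.
  - rewrite (_ : series _ =
        (fun n => 2 * L * series (fun n => `|a n.+1 - a n|) n)); last first.
      by apply/funext => n; rewrite /series /= mulr_sumr.
    by apply: is_cvgMr.
pose ratio n := `|1 - (a n.+1 / a n)^-1|.
have ratio0 : ratio n @[n --> \oo] --> (0 : R).
  rewrite -(normr0 R) -(subrr 1); apply: cvg_norm; apply: cvgB;
    first exact: cvg_cst.
  by rewrite -[X in _ --> X]invr1; apply: cvgV.
apply: (recursive_cvg0 (b := fun n => tau * a n.+1)
  (d := fun n => 2 * L / tau * ratio n) (e := fun=> 0)) => //.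
- apply: filterS near_rec => n; rewrite addr0; congr (_ <= _ + _).
  have a0 := a_gt0 n; have a'0 := a_gt0 n.+1.
  have -> : a n.+1 - a n = a n.+1 * (1 - (a n.+1 / a n)^-1).
    by field; rewrite !gt_eqF.
  rewrite normrM (gtr0_norm a'0) -/(ratio n).
  by field; rewrite gt_eqF.
- move=> eps eps0.
  have cv : 2 * L / tau * ratio n @[n --> \oo] --> 2 * L / tau * 0.
    by apply: cvgM => //; exact: cvg_cst.
  rewrite mulr0 in cv; have /cvgr0Pnorm_le/(_ eps eps0) := cv.
  by apply: filterS => n; apply: le_trans; exact: ler_norm.
- rewrite (_ : series _ = fun=> 0); first exact: is_cvg_cst.
  by apply/funext => n; rewrite /series /= big1.
Unshelve. all: by end_near. Qed.

(** Pass through [x n.+1] and [y n]: the first gap tends to 0, the second is at most a(n) L, and the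
    third is at most half the first by nonexpansiveness. *)
Lemma displacement_cvg0 : `|x n - S (x n)| @[n --> \oo] --> (0 : R).
Proof.
have [L L0 near_L] := forcing_bounded.
have upper_cvg : 2 * `|x n.+1 - x n| + a n * L @[n --> \oo] --> 2 * 0 + 0 * L.
  apply: cvgD; apply: cvgM => //; try exact: cvg_cst.
  exact: increments_cvg0.
rewrite mulr0 mul0r addr0 in upper_cvg.
apply: squeeze_cvgr (cvg_cst _) upper_cvg.
near=> n; rewrite normr_ge0/=.
have -> : x n - S (x n) = (x n - x n.+1) + (x n.+1 - y n) + (y n - S (x n)).
  by rewrite -addrA subrKA subrKA.
have hS : `|y n - S (x n)| <= `|x n.+1 - x n| / 2.
  apply: le_trans (S_nonexp _ _) _.
  have -> : 2^-1 *: (x n + x n.+1) - x n = 2^-1 *: (x n.+1 - x n).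
    by rewrite -[X in _ - X]half_double -scalerBr opprD addrACA subrr add0r.
  by rewrite normrZ ger0_norm// mulrC.
have hy : `|x n.+1 - y n| <= a n * L.
  rewrite x_scheme addrAC subrr add0r normrZ gtr0_norm// ler_pM2l//.
  by near: n.
have := ler_normD (x n - x n.+1 + (x n.+1 - y n)) (y n - S (x n)).
have := ler_normD (x n - x n.+1) (x n.+1 - y n).
have := normr_ge0 (x n.+1 - x n); rewrite [`|x n - _|]distrC; lra.
Unshelve. all: by end_near. Qed.

Lemma sqr_dist_rec n z e : small (a n) -> Fix S z -> 0 <= e ->
    - ip (B z - f z) (x n.+1 - z) <= e ->
  `|x n.+1 - z| ^+ 2 <= (1 - 2 * tau * a n) * `|x n - z| ^+ 2 + 4 * a n * e.
Proof.
move=> ss Sz e0 ip_le; have a0 := a_gt0 n.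
pose w := y n - z.
(* The new error splits into a damped midpoint error and a perturbation of order a(n), to be paired
   with the new error itself. *)
have xE : x n.+1 - z = (w - a n *: B w) +
    (a n *: (f (x n) - f z) - a n *: (B z - f z)).
  have -> : x n.+1 - z = (y n + a n *: (f (x n) - B (y n))) -
      (z + a n *: (f z - B z)) + a n *: (f z - B z).
    by rewrite x_scheme opprD addrA subrK.
  by rewrite stepB -addrA -[B z - f z]opprB scalerN opprK.
have := sqr_normD_le ip_norm (w - a n *: B w)
    (a n *: (f (x n) - f z) - a n *: (B z - f z)).
rewrite -xE ipDl ipNl !ipZl.
have := damping_sqr w (ltW a0) ss.
have fx : ip (f (x n) - f z) (x n.+1 - z) <=
  kappa * (`|x n - z| * `|x n.+1 - z|).
  apply: le_trans (ip_le_norm ip_norm _ _) _.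
  by rewrite mulrA ler_wpM2r.
have wr := midpoint_dist n Sz; rewrite -/w in wr.
move: fx ip_le wr (normr_ge0 w) (normr_ge0 (x n - z)) (normr_ge0 (x n.+1 - z)).
move: (ip _ _) (ip _ _) (`|w - _| ^+ 2) => g h q.
move: `|w| `|x n - z| `|x n.+1 - z| => w' r r' gr he wr w0 r0 r'0 qw r'q.
case: ss => _ ss; move: (a n) a0 ss qw r'q => s s0 ss qw r'q.
have w2 : w' ^+ 2 <= (r ^+ 2 + r' ^+ 2) / 2.
  have : w' ^+ 2 <= ((r + r') / 2) ^+ 2
    by rewrite lerXn2r ?nnegrE// divr_ge0 ?addr_ge0.
  have := sqr_ge0 (r - r'); lra.
have c0 : 0 <= 1 - 2 * s * (kappa + tau) by lra.
have h1 := ler_wpM2l c0 w2.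
have h2 := ler_wpM2l (ltW s0) gr.
have h3 := ler_wpM2l (ltW s0) he.
(* Splitting r r' by this square and collecting r'^2 gives (1 + 2 s tau) r'^2 <= (1 - 2 s tau) r^2 +
   4 s e. *)
have h4 : 0 <= s * kappa * (r - r') ^+ 2
  by rewrite mulr_ge0 ?sqr_ge0// mulr_ge0// ltW.
have h5 : 0 <= tau * s * r' ^+ 2 by rewrite mulr_ge0 ?sqr_ge0// mulr_ge0// ltW.
lra.
Qed.

Lemma operator_strongly_monotone u v :
  2 * tau * `|u - v| ^+ 2 <= ip ((B u - f u) - (B v - f v)) (u - v).
Proof.
have := B_strong (u - v); have := ip_le_norm ip_norm (f u - f v) (u - v).
have : `|f u - f v| * `|u - v| <= kappa * `|u - v| ^+ 2.
  by rewrite expr2 mulrA ler_wpM2r.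
rewrite [B (u - v)]linearB.
have -> : ip (B u - f u - (B v - f v)) (u - v) =
    ip (B u - B v) (u - v) - ip (f u - f v) (u - v) by rewrite !ipE; ring.
lra.
Qed.

Theorem implicit_midpoint_cvg : exists z,
  x n @[n --> \oo] --> z /\ solves_VI ip (fun u => B u - f u) (Fix S) z.
Proof.
have F_strong := operator_strongly_monotone.
have F_lip u v : `|(B u - f u) - (B v - f v)| <= (M + kappa) * `|u - v|.
  have -> : B u - f u - (B v - f v) = B (u - v) - (f u - f v).
    by rewrite [B (u - v)]linearB opprD opprK addrACA opprB [f v - _]addrC.
  by apply: le_trans (ler_normB _ _) _; rewrite mulrDl lerD.
have tau2_gt0 : 0 < 2 * tau by rewrite mulr_gt0.
have [z z_sol zP] := exists_fix_VI ip_norm tau2_gt0 F_strong S_nonexp S_fix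
  F_lip.
exists z; split=> //; have [Sz _] := z_sol.
have [D D0 near_D] := iterates_bounded Sz.
have ip_near (e : R) : 0 < e -> \forall n \near \oo,
    - ip (B z - f z) (x n.+1 - z) <= e.
  move=> e0; have [d d0 dP] := zP D e e0.
  have near_d : \forall n \near \oo, `|x n - S (x n)| <= d.
    have /cvgr0Pnorm_le/(_ d d0) := displacement_cvg0.
    by apply: filterS => n; rewrite normr_id.
  apply: (near_succ (P := fun n => - ip (B z - f z) (x n - z) <= e)).
  by near=> n; apply: dP; near: n.
have sqr_cvg0 : `|x n - z| ^+ 2 @[n --> \oo] --> (0 : R).
  (* The positive part meets the sign condition of the recursion; the index n + 1 reflects the
     implicit pairing. The factor 2 / tau below turns 2 tau a(n) into 4 a(n). *)
  pose del n := Num.max 0 (- ip (B z - f z) (x n.+1 - z)).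
  apply: (recursive_cvg0 (b := fun n => 2 * tau * a n)
    (d := fun n => 2 / tau * del n) (e := fun=> 0)) => //.
  - near=> n; have a0 := a_gt0 n; rewrite ltW ?mulr_gt0//=.
    have [_] : small (a n) by near: n; exact: near_small.
    have : 0 <= a n * kappa by rewrite mulr_ge0// ltW.
    lra.
  - near=> n; rewrite addr0.
    have -> : 2 * tau * a n * (2 / tau * del n) = 4 * a n * del n.
      by field; rewrite gt_eqF.
    apply: sqr_dist_rec => //.
    + by near: n; exact: near_small.
    + by rewrite le_max lexx.
    + by rewrite le_max lexx orbT.
  - exact: series_scale_pinfty.
  - move=> eps eps0; near=> n.
    rewrite mulrAC ler_pdivrMr// mulrC -ler_pdivlMr// ge_max.
    apply/andP; split; first by rewrite !mulr_ge0 ?ltW.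
    by near: n; apply: ip_near; rewrite !mulr_gt0.
  - rewrite (_ : series _ = fun=> 0); first exact: is_cvg_cst.
    by apply/funext => n; rewrite /series /= big1.
apply/cvgrPdist_le => e e0.
have /cvgr0Pnorm_le/(_ (e ^+ 2)) := sqr_cvg0.
rewrite exprn_gt0// => /(_ isT); apply: filterS => n.
by rewrite ger0_norm ?sqr_ge0// distrC ler_sqr ?nnegrE// ltW.
Unshelve. all: by end_near. Qed.

End ImplicitMidpoint.

(** * The projected step and the solutions of (VIP) *)

Section ProjectedGradient.
Context {R : realType} {H : completeNormedModType R} (ip : {dot H for idfun})
  (ip_norm : induces_norm ip) (K : set H) (K_nonempty : K !=set0)
  (K_closed : closed K) (K_convex : convex_set (K : set (convex_lmodType H)))
  (A : H -> H) (lambda : R) (lambda_gt0 : 0 < lambda).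

(** Expanding the square, inverse strong monotonicity leaves |u - v|^2 - lambda (2 mu - lambda) |A u
    - A v|^2 before projecting. *)
Lemma proj_step_nonexpansive (mu : R) : inverse_strongly_monotone ip mu A ->
    lambda < 2 * mu ->
  forall u v, `|proj_step K A lambda u - proj_step K A lambda v| <= `|u - v|.
Proof.
move=> A_ism lambda_lt u v; rewrite /proj_step.
set u' := u - _; set v' := v - _.
have [Ku uP] := metric_projP ip_norm u' K_nonempty K_closed K_convex.
have [Kv vP] := metric_projP ip_norm v' K_nonempty K_closed K_convex.
apply: le_trans (projection_nonexpansive ip_norm (uP _ Kv) (vP _ Ku)) _.
have -> : u' - v' = (u - v) - lambda *: (A u - A v).
  by rewrite scalerBr [in RHS]opprB opprD opprK addrACA; congr (_ + _);
    exact: addrC.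
rewrite -ler_sqr ?nnegrE// (sqr_normB ip_norm (u - v)) ipZr normrZ exprMn.
rewrite (gtr0_norm lambda_gt0) (ip_sym ip (u - v)).
have h1 := ler_wpM2l (ltW lambda_gt0) (A_ism u v).
have h2 : 0 <= lambda * (2 * mu - lambda) * `|A u - A v| ^+ 2.
  by rewrite mulr_ge0 ?sqr_ge0// mulr_ge0 ?subr_ge0 ?ltW.
lra.
Qed.

(** At a fixed point, the angle condition for z - lambda A z is the variational inequality times
    -lambda. *)
Lemma fix_proj_stepP z : Fix (proj_step K A lambda) z <-> solves_VI ip A K z.
Proof.
have ipE' v : ip (z - lambda *: A z - z) (v - z) = - (lambda * ip (A z) (v -
  z)).
  by rewrite addrAC subrr add0r ipNl ipZl.
split=> [Sz|[Kz zP]].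
  have [] := metric_projP ip_norm (z - lambda *: A z) K_nonempty K_closed
    K_convex.
  rewrite -/(proj_step K A lambda z) Sz => Kz zP; split=> // v /zP.
  by rewrite ipE' oppr_le0 pmulr_rge0.
apply: (metric_proj_eq ip_norm) => // v /zP ge0.
by rewrite ipE' oppr_le0 pmulr_rge0.
Qed.

End ProjectedGradient.

(** * Strong convergence of the scheme to the selected solution of (VIP) *)

Theorem theorem4p1 (R : realType) (H : completeNormedModType R)
  (ip : {dot H for idfun}) (ip_norm : induces_norm ip)
  (K : set H) (K_nonempty : K !=set0) (K_closed : closed K)
  (K_convex : convex_set (K : set (convex_lmodType H)))
  (A : H -> H) (A_monotone : monotone_map ip A)
  (theta : R) (theta_gt0 : 0 < theta) (A_lipschitz : theta.-lipschitz A)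
  (mu : R) (mu_gt0 : 0 < mu) (A_ism : inverse_strongly_monotone ip mu A)
  (lambda : R) (lambda_gt0 : 0 < lambda) (lambda_lt : lambda < 2 * mu)
  (VIP_solvable : exists xstar : H, solves_VI ip A K xstar)
  (B : {linear H -> H}) (B_bounded : bounded_operator B)
  (gbar : R) (gbar_gt0 : 0 < gbar) (B_strongly_positive : strongly_positive ip gbar B)
  (Q : H -> H) (alpha : R) (alpha_gt0 : 0 < alpha) (alpha_lt1 : alpha < 1)
  (Q_contraction : alpha.-lipschitz Q)
  (gamma : R) (gamma_gt0 : 0 < gamma) (gamma_lt : gamma < gbar / alpha)
  (gbar_lt : gbar / alpha < gamma + 1 / alpha)
  (a : nat -> R) (a_gt0 : forall n, 0 < a n) (a_lt1 : forall n, a n < 1)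
  (a_cvg0 : a n @[n --> \oo] --> (0 : R))
  (a_sum : series a n @[n --> \oo] --> +oo)
  (a_var : cvgn (series (fun n => `|a n.+1 - a n|)) \/
           a n.+1 / a n @[n --> \oo] --> (1 : R))
  (x : nat -> H)
  (x_scheme : forall n,
     let y := proj_step K A lambda (2^-1 *: (x n + x n.+1)) in
     x n.+1 = (a n * gamma) *: Q (x n) + (y - a n *: B y)) :
  let S := proj_step K A lambda in
  exists z : H,
    [/\ x n @[n --> \oo] --> z,
        solves_VI ip A K z,
        solves_VI ip (fun u => B u - gamma *: Q u) (Fix S) z
      & forall w : H,
          solves_VI ip (fun u => B u - gamma *: Q u) (Fix S) w -> w = z].
Proof.
move=> S.
have S_nonexp := proj_step_nonexpansive ip_norm K_nonempty K_closed K_convex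
  lambda_gt0 A_ism lambda_lt.
have SP := fix_proj_stepP ip_norm K_nonempty K_closed K_convex A lambda_gt0.
have S_fix : Fix S !=set0 by have [p pP] := VIP_solvable; exists p; apply/SP.
have [M B_bound] := B_bounded.
(* Here [kappa] is the Lipschitz constant of gamma Q, and [tau] is positive because gamma < gbar /
   alpha. *)
pose kappa := gamma * alpha; pose tau := (gbar - kappa) / 2.
have kappa_ge0 : 0 <= kappa by rewrite mulr_ge0 ?ltW.
have tau_gt0 : 0 < tau by rewrite divr_gt0// subr_gt0 -ltr_pdivlMr.
have B_strong : strongly_positive ip (kappa + 2 * tau) B.
  by rewrite (_ : kappa + 2 * tau = gbar)// /tau; field.
have f_lip u v : `|gamma *: Q u - gamma *: Q v| <= kappa * `|u - v|.
  rewrite -scalerBr normrZ gtr0_norm// -mulrA ler_pM2l//.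
  by move/lipschitzP : Q_contraction; exact.
have scheme n : x n.+1 = S (2^-1 *: (x n + x n.+1)) +
    a n *: (gamma *: Q (x n) - B (S (2^-1 *: (x n + x n.+1)))).
  by rewrite [LHS]x_scheme scalerBr scalerA addrCA.
have [z [x_cvg z_sol]] := implicit_midpoint_cvg ip_norm S_nonexp S_fix kappa_ge0
  tau_gt0 B_bound B_strong f_lip a_gt0 a_cvg0 a_sum a_var scheme.
exists z; split=> //; first by apply/SP; exact: z_sol.1.
have F_strong u v : 2 * tau * `|u - v| ^+ 2 <=
    ip ((B u - gamma *: Q u) - (B v - gamma *: Q v)) (u - v).
  exact: (operator_strongly_monotone ip_norm B_strong f_lip).
have tau2_gt0 : 0 < 2 * tau by rewrite mulr_gt0.
by move=> w; exact: (strongly_monotone_VI_unique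
  (F := fun u => B u - gamma *: Q u) tau2_gt0 F_strong z_sol).
Qed.
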